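(* Let $\Gamma$ be a finite nonempty graph and let $A(\Gamma)$ be the associated right-angled Artin group. If $A(\Gamma)$ has multiple context-free word problem, then $\Gamma\in\mathcal{G}$, where $\mathcal{G}$ is the smallest class of graphs (closed under isomorphism) that contains the one-vertex graph and is closed under the following operations: (i) if $\Gamma_1,\Gamma_2\in\mathcal{G}$, then $\Gamma_1\sqcup\Gamma_2\in\mathcal{G}$; (ii) if $\Gamma_1\in\mathcal{G}$, then $\Gamma_1\ast\{v\}\in\mathcal{G}$.
   Context: Graphs are undirected, with no loops and no multiple edges. $\Gamma_1\sqcup\Gamma_2$ denotes the disjoint union of graphs, and $\Gamma_1\ast\{v\}$ (the cone, or join with a point) denotes the graph obtained from $\Gamma_1$ by adding one new vertex $v$ joined by an edge to every vertex of $\Gamma_1$. The right-angled Artin group (RAAG) $A(\Gamma)$ is the group with one generator for each vertex $v\in V(\Gamma)$ and defining relations $vw=wv$ for each pair of vertices $v,w$ joined by an edge of $\Gamma$. Word problem: a choice of generators for a group $G$ is a surjective monoid homomorphism $\pi:\Sigma^*\to G$, where $\Sigma$ is a finite nonempty alphabet equipped with a fixed-point-free involution $a\mapsto a^{-1}$ satisfying $\pi(a^{-1})=\pi(a)^{-1}$ for all $a\in\Sigma$, and $\Sigma^*$ is the free monoid on $\Sigma$. The word problem of $G$ is the language $\operatorname{WP}(G)=\pi^{-1}(1)\subset\Sigma^*$. Whether it is multiple context-free does not depend on the choice of generators. Multiple context-free (MCF) languages: a multiple context-free grammar over a finite alphabet $\Sigma$ consists of a finite set $N$ of nonterminals, each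 $A\in N$ having a dimension $d(A)\ge 1$; a start symbol $S\in N$ with $d(S)=1$; and a finite set of rules $A\to f[A_1,\dots,A_k]$ with $k\ge 0$, $A,A_1,\dots,A_k\in N$, where $f:(\Sigma^* )^{d(A_1)}\times\cdots\times(\Sigma^* )^{d(A_k)}\to(\Sigma^* )^{d(A)}$ is a function each of whose $d(A)$ components is a fixed concatenation of letters of $\Sigma$ and variables $x_{ij}$ ($1\le i\le k$, $1\le j\le d(A_i)$; $x_{ij}$ stands for the $j$-th entry of the $i$-th argument), such that each variable $x_{ij}$ occurs at most once in total across all components of $f$. The sets $L(A)\subset(\Sigma^* )^{d(A)}$, $A\in N$, are the smallest sets such that for every rule $A\to f[A_1,\dots,A_k]$ and all $t_i\in L(A_i)$ one has $f(t_1,\dots,t_k)\in L(A)$. The language generated is $L(S)\subset\Sigma^*$. A language is multiple context-free if it is generated by some multiple context-free grammar. *)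

(* Defs.v *)
From HB Require Import structures.
From mathcomp Require Import all_boot.
From mathcomp Require Import boolp classical_sets.

Set Implicit Arguments.
Unset Strict Implicit.
Unset Printing Implicit Defensive.

Local Open Scope quotient_scope.
Local Open Scope classical_set_scope.

Record sgraph := SGraph {
  vertex : finType;
  adj : rel vertex;
  adj_sym : symmetric adj;
  adj_irr : irreflexive adj }.

Definition graph_iso (Γ1 Γ2 : sgraph) : Prop :=
  exists2 f : vertex Γ1 -> vertex Γ2,
    bijective f & forall x y, adj (f x) (f y) = adj x y.

Section GraphOperations.
Variables Γ1 Γ2 : sgraph.

Lemma point_adj_sym : symmetric (fun _ _ : unit => false).
Proof. by []. Qed.

Lemma point_adj_irr : irreflexive (fun _ _ : unit => false).
Proof. by []. Qed.

Definition point_graph : sgraph := SGraph point_adj_sym point_adj_irr.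

Definition union_adj (x y : vertex Γ1 + vertex Γ2) : bool :=
  match x, y with
  | inl a, inl b => adj a b
  | inr a, inr b => adj a b
  | _, _ => false
  end.

Lemma union_adj_sym : symmetric union_adj.
Proof. by case=> a [] b //=; exact: adj_sym. Qed.

Lemma union_adj_irr : irreflexive union_adj.
Proof. by case=> a /=; exact: adj_irr. Qed.

Definition graph_union : sgraph := SGraph union_adj_sym union_adj_irr.

(* The apex of the cone is [None]. *)
Definition cone_adj (x y : option (vertex Γ1)) : bool :=
  match x, y with
  | Some a, Some b => adj a b
  | None, None => false
  | _, _ => true
  end.

Lemma cone_adj_sym : symmetric cone_adj.
Proof. by case=> [a|] [b|] //=; exact: adj_sym. Qed.

Lemma cone_adj_irr : irreflexive cone_adj.
Proof. by case=> [a|] //=; exact: adj_irr. Qed.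

Definition graph_cone : sgraph := SGraph cone_adj_sym cone_adj_irr.

End GraphOperations.

Inductive calG : sgraph -> Prop :=
| calG_point : calG point_graph
| calG_iso Γ1 Γ2 : graph_iso Γ1 Γ2 -> calG Γ1 -> calG Γ2
| calG_union Γ1 Γ2 : calG Γ1 -> calG Γ2 -> calG (graph_union Γ1 Γ2)
| calG_cone Γ1 : calG Γ1 -> calG (graph_cone Γ1).

Section RAAG.
Variable Γ : sgraph.

(* The letter [(v, true)] stands for v and [(v, false)] for its inverse. *)
Definition raag_word : Type := seq (vertex Γ * bool).

Inductive raag_cong : raag_word -> raag_word -> Prop :=
| raag_cong_refl u : raag_cong u u
| raag_cong_sym u v : raag_cong u v -> raag_cong v u
| raag_cong_trans v u w : raag_cong u v -> raag_cong v w -> raag_cong u w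
| raag_cong_cat u u' v v' :
    raag_cong u u' -> raag_cong v v' -> raag_cong (u ++ v) (u' ++ v')
| raag_cong_inv v b : raag_cong [:: (v, b); (v, ~~ b)] [::]
| raag_cong_comm v w : adj v w ->
    raag_cong [:: (v, true); (w, true)] [:: (w, true); (v, true)].

Definition raag_rel (u v : raag_word) : bool := `[< raag_cong u v >].

Lemma raag_rel_equiv : equiv_class_of raag_rel.
Proof.
split=> [u|u v|v u w]; first exact/asboolP/raag_cong_refl.
  by apply/asboolP/asboolP; exact: raag_cong_sym.
by move=> /asboolP uv /asboolP vw; apply/asboolP; exact: raag_cong_trans vw.
Qed.

Canonical raag_equiv := EquivRelPack raag_rel_equiv.

Definition raag : Type := {eq_quot raag_equiv}.
HB.instance Definition _ := Choice.on raag.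

Definition raag_class (u : raag_word) : raag := \pi_({eq_quot raag_equiv}) u.

Lemma raag_classP (u v : raag_word) :
  raag_class u = raag_class v <-> raag_cong u v.
Proof. by split=> [/eqmodP/asboolP|uv] //; apply/eqmodP/asboolP. Qed.

Lemma raag_classK (x : raag) : raag_class (repr x) = x.
Proof. exact: reprK. Qed.

Lemma raag_class_surj (x : raag) : exists u, x = raag_class u.
Proof. by exists (repr x); rewrite raag_classK. Qed.

Definition raag_word_inv (u : raag_word) : raag_word :=
  rev [seq (x.1, ~~ x.2) | x <- u].

Definition raag_one : raag := raag_class [::].
Definition raag_mul (x y : raag) : raag := raag_class (repr x ++ repr y).
Definition raag_inv (x : raag) : raag := raag_class (raag_word_inv (repr x)).

Lemma raag_word_invK : involutive raag_word_inv.
Proof.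
move=> u; rewrite /raag_word_inv map_rev revK -map_comp map_id_in //.
by case=> v b _ /=; rewrite negbK.
Qed.

Lemma raag_word_mulV (u : raag_word) : raag_cong (u ++ raag_word_inv u) [::].
Proof.
elim: u => [|[v b] u IHu] /=; first exact: raag_cong_refl.
rewrite /raag_word_inv /= rev_cons -cats1.
apply: raag_cong_trans (raag_cong_inv v b).
apply: (@raag_cong_cat [:: (v, b)] [:: (v, b)]); first exact: raag_cong_refl.
rewrite catA; apply: (@raag_cong_cat _ [::] _ [:: (v, ~~ b)]) => //.
exact: raag_cong_refl.
Qed.

Lemma raag_word_mulVl (u : raag_word) : raag_cong (raag_word_inv u ++ u) [::].
Proof. by have := raag_word_mulV (raag_word_inv u); rewrite raag_word_invK. Qed.

Lemma raag_mul_class (u v : raag_word) :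
  raag_mul (raag_class u) (raag_class v) = raag_class (u ++ v).
Proof.
by apply/raag_classP/raag_cong_cat; apply/raag_classP; rewrite raag_classK.
Qed.

Lemma raag_mulA : associative raag_mul.
Proof.
move=> x y z; have [u ->] := raag_class_surj x.
have [v ->] := raag_class_surj y; have [w ->] := raag_class_surj z.
by rewrite [raag_mul (raag_class v) _]raag_mul_class
  [raag_mul (raag_class u) (raag_class v)]raag_mul_class !raag_mul_class catA.
Qed.

Lemma raag_mul1 : left_id raag_one raag_mul.
Proof. by move=> x; have [u ->] := raag_class_surj x; exact: raag_mul_class. Qed.

Lemma raag_mulr1 : right_id raag_one raag_mul.
Proof.
move=> x; have [u ->] := raag_class_surj x.
by rewrite -[in RHS](cats0 u); exact: raag_mul_class.
Qed.

Lemma raag_mulV : left_inverse raag_one raag_inv raag_mul.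
Proof.
move=> x; rewrite -{2}[x]raag_classK /raag_inv raag_mul_class.
by apply/raag_classP; exact: raag_word_mulVl.
Qed.

Lemma raag_mulrV : right_inverse raag_one raag_inv raag_mul.
Proof.
move=> x; rewrite -{1}[x]raag_classK /raag_inv raag_mul_class.
by apply/raag_classP; exact: raag_word_mulV.
Qed.

HB.instance Definition _ :=
  isGroup.Build raag raag_mulA raag_mul1 raag_mulr1 raag_mulV raag_mulrV.

End RAAG.

Record mcf_rule (T N : finType) (dim : N -> nat) := MCFRule {
  rule_lhs : N;
  rule_arity : nat;
  rule_arg : 'I_rule_arity -> N;
  (* In the components, [inl a] is a letter, and [inr (existT _ i j)] is the
     variable x_ij standing for the j-th entry of the i-th argument. *)
  rule_comp : (dim rule_lhs).-tuple
    (seq (T + {i : 'I_rule_arity & 'I_(dim (rule_arg i))}));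
  rule_linear : forall x : {i : 'I_rule_arity & 'I_(dim (rule_arg i))},
    count_mem (inr x) (flatten rule_comp) <= 1 }.
Arguments rule_arg {T N dim} r i : rename.

Record mcf_grammar (T : finType) := MCFGrammar {
  nonterminal : finType;
  dim : nonterminal -> nat;
  dim_gt0 : forall A, 0 < dim A;
  start : nonterminal;
  dim_start : dim start = 1;
  rule_index : finType;
  rule : rule_index -> mcf_rule T dim }.

Section MCF.
Variable T : finType.

Definition rule_subst (N : finType) (dim : N -> nat) (r : mcf_rule T dim)
    (t : forall i, (dim (rule_arg r i)).-tuple (seq T))
    (s : seq (T + {i : 'I_(rule_arity r) & 'I_(dim (rule_arg r i))})) : seq T :=
  flatten [seq match x with
               | inl a => [:: a]
               | inr (existT i j) => tnth (t i) j
               end | x <- s].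

Definition rule_fun (N : finType) (dim : N -> nat) (r : mcf_rule T dim)
    (t : forall i, (dim (rule_arg r i)).-tuple (seq T)) :
    (dim (rule_lhs r)).-tuple (seq T) :=
  map_tuple (rule_subst t) (rule_comp r).

Inductive mcf_derives (g : mcf_grammar T) :
    forall A : nonterminal g, (dim A).-tuple (seq T) -> Prop :=
| MCFDerives (k : rule_index g)
    (t : forall i, (dim (rule_arg (rule k) i)).-tuple (seq T)) :
    (forall i, mcf_derives (t i)) -> mcf_derives (rule_fun t).

(* L(S), the 1-tuples over words being identified with words. *)
Definition mcf_lang (g : mcf_grammar T) : set (seq T) :=
  [set w | exists2 t : (dim (start g)).-tuple (seq T),
     mcf_derives t & tval t = [:: w]].

Definition multiple_context_free (L : set (seq T)) : Prop :=
  exists g : mcf_grammar T, mcf_lang g = L.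

End MCF.

Record choice_of_generators (G : groupType) := ChoiceOfGenerators {
  alphabet : finType;
  alphabet_gt0 : 0 < #|alphabet|;
  letter_inv : alphabet -> alphabet;
  letter_invK : involutive letter_inv;
  letter_inv_neq : forall a, letter_inv a != a;
  word_val : seq alphabet -> G;
  word_val_nil : word_val [::] = 1%g;
  word_val_cat : forall u v, word_val (u ++ v) = (word_val u * word_val v)%g;
  word_val_surj : forall x : G, exists w, word_val w = x;
  word_val_inv : forall a, word_val [:: letter_inv a] = (word_val [:: a])^-1%g }.
Arguments word_val {G} X w : rename.

Definition word_problem (G : groupType) (X : choice_of_generators G) :
    set (seq (alphabet X)) :=
  [set w | word_val X w = 1%g].
Arguments word_problem {G} X _ : rename.

(* The existential quantifier is harmless: multiple context-freeness of the word
   problem does not depend on the choice of generators. *)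
Definition has_mcf_word_problem (G : groupType) : Prop :=
  exists X : choice_of_generators G, multiple_context_free (word_problem X).

(* Main.v *)
Require Import Defs.
From mathcomp Require Import all_boot.
From mathcomp Require Import boolp.
From mathcomp Require Import zify.

(** The nonempty graphs obtained from points by disjoint unions and cones are those
    without an induced path or cycle on four vertices [calG_of_no_path]. Both
    are covered by one pattern: vertices a, b, c, d with edges ab, bc, cd and
    non-edges ac, bd, the vertices a and d being adjacent in the cycle and not in
    the path. It remains to show that the word problem of the right-angled Artin
    group of a graph with this pattern is not multiple context-free.

    The obstruction is arithmetical. Let words be read by a finite automaton
    whose transitions have weight 0 or 1. The weights of the words of a multiple
    context-free language read between two given states are either bounded or
    contain an infinite arithmetic progression [mcf_weights]. The reason is the
    pumping argument for context-free grammars over one letter: once the end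
    states of all components of a derived tuple are prescribed, a rule adds up
    the weights of its arguments and a constant, because it uses each variable
    at most once. In a group with multiple context-free word problem the same
    dichotomy therefore holds for the weights of the paths labelled by the
    identity in any finite graph with edges labelled by group elements
    [mcf_rational_weights].

    With the pattern one builds such a labelled graph in which these weights are
    powers of 2 of unbounded size, among which there is no infinite arithmetic
    progression. Consider the positive words
<<
      a d (c b b)^n1  a d (c b b)^n2 ... a d (c b b)^nk
      a c  d a (b c)^m1  d a (b c)^m2 ...  d b^m
>>
    which a finite graph can compare: follow the first, then the inverse of the
    second, counting the final letters b. Deleting all letters but two that are
    not adjacent maps the group to a free group, where distinct positive words
    are distinct [positive_proj]. For the pair a, c this gives n1 = 1 and
    n(i+1) = mi; for the pair b, d it gives mi = 2 ni, the last one being m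
    [equal_words_weight]. Hence m is a power of 2. Conversely, for these
    exponents the two words are equal, using only that ab, bc and cd commute
    [equal_words_exist]. *)

Set Implicit Arguments.
Unset Strict Implicit.
Unset Printing Implicit Defensive.

(** * Graphs without induced path or cycle on four vertices *)

Section InducedSubgraphs.
Variable Γ : sgraph.
Implicit Types A B : {set vertex Γ}.

Definition induced_adj A (x y : {x | x \in A}) := adj (val x) (val y).

Lemma induced_adj_sym A : symmetric (@induced_adj A).
Proof. by move=> x y; exact: adj_sym. Qed.

Lemma induced_adj_irr A : irreflexive (@induced_adj A).
Proof. by move=> x; exact: adj_irr. Qed.

Definition induced A : sgraph := SGraph (@induced_adj_sym A) (@induced_adj_irr A).

Lemma induced_setT : graph_iso (induced setT) Γ.
Proof.
exists val => //; exists (fun x => Sub x (in_setT x)) => x; last exact: SubK.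
by apply: val_inj.
Qed.

Lemma induced_set1 v : graph_iso point_graph (induced [set v]).
Proof.
exists (fun=> Sub v (set11 v)) => [|[] []]; last exact: adj_irr.
exists (fun=> tt) => [[]//|x]; apply: val_inj => /=.
by have := valP x; rewrite inE => /eqP.
Qed.

Lemma induced_union A B : B \subset A ->
  (forall x y, x \in B -> y \in A -> y \notin B -> adj x y = false) ->
  graph_iso (graph_union (induced B) (induced (A :\: B))) (induced A).
Proof.
move=> sBA sepB; have /subsetP BA := sBA.
have DA x : x \in A :\: B -> x \in A by case/setDP.
pose f (x : vertex (graph_union (induced B) (induced (A :\: B)))) :
    vertex (induced A) :=
  match x with
  | inl y => Sub (val y) (BA _ (valP y))
  | inr y => Sub (val y) (DA _ (valP y))
  end.
exists f.
  apply: inj_card_bij.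
    move=> x y /(congr1 val); case: x y => [[x xB]|[x xD]] [[y yB]|[y yD]] //= xy.
    - by congr inl; apply: val_inj.
    - by exfalso; move: yD; rewrite -xy inE xB.
    - by exfalso; move: xD; rewrite xy inE yB.
    - by congr inr; apply: val_inj.
  rewrite card_sum !card_sig.
  suff -> : #|[pred x in A]| = #|B| + #|A :\: B| by [].
  by rewrite -{1}(setIidPr sBA) cardsID.
case=> [[x xB]|[x xD]] [[y yB]|[y yD]] //=.
- by rewrite /induced_adj /= sepB //; case/setDP: yD.
- by rewrite /induced_adj /= adj_sym sepB //; case/setDP: xD.
Qed.

Lemma induced_cone A v : v \in A -> (forall x, x \in A -> x != v -> adj v x) ->
  graph_iso (graph_cone (induced (A :\ v))) (induced A).
Proof.
move=> vA dom.
have DA x : x \in A :\ v -> x \in A by case/setD1P.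
pose f (x : vertex (graph_cone (induced (A :\ v)))) : vertex (induced A) :=
  if x is Some y then Sub (val y) (DA _ (valP y)) else Sub v vA.
exists f.
  apply: inj_card_bij.
    move=> x y /(congr1 val); case: x y => [[x xD]|] [[y yD]|] //= xy.
    - by congr Some; apply: val_inj.
    - by exfalso; move: xD; rewrite xy !inE eqxx.
    - by exfalso; move: yD; rewrite -xy !inE eqxx.
  rewrite card_option !card_sig.
  suff -> : #|[pred x in A]| = #|A :\ v|.+1 by [].
  by rewrite [LHS](cardsD1 v A) vA.
case=> [[x xD]|] [[y yD]|] //=; rewrite /induced_adj /=.
- by rewrite adj_sym; case/setD1P: xD => xv xA; rewrite dom.
- by case/setD1P: yD => yv yA; rewrite dom.
- exact: adj_irr.
Qed.

(** Let [v] have the largest degree in an induced subgraph [A]. If a neighbour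
    [x] of [v] had a neighbour [y] outside the closed neighbourhood of [v], then
    [x] could not be adjacent to all other neighbours of [v], and a neighbour [z]
    it misses would give the forbidden [z], [v], [x], [y]. So the closed
    neighbourhood of [v] is a union of components: either it splits off, or it is
    [A] and [v] is the apex of a cone. *)
Lemma calG_of_no_path :
  (forall a b c d : vertex Γ, adj a b -> adj b c -> adj c d -> a != c -> b != d ->
     ~~ adj a c -> ~~ adj b d -> False) ->
  0 < #|vertex Γ| -> calG Γ.
Proof.
move=> nopath Γ_gt0; apply: calG_iso induced_setT _.
have : 0 < #|[set: vertex Γ]| by rewrite cardsT.
move: {2}#|_| (leqnn #|[set: vertex Γ]|) => n.
elim: n [set: _] => [|n IHn] A leAn; first by rewrite ltnNge leAn.
move=> /card_gt0P[v0 v0A].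
pose N (u : vertex Γ) := [set x in A | adj u x].
case: (@arg_maxnP _ v0 [in A] (fun u => #|N u|) v0A) => v vA vmax.
pose C := v |: N v.
have CA : C \subset A.
  by apply/subsetP => x; rewrite !inE => /predU1P[->|/andP[]].
have sepC x y : x \in C -> y \in A -> y \notin C -> adj x y = false.
  rewrite !inE => + yA; rewrite yA negb_or /=.
  move=> /predU1P[->|/andP[xA vx]] /andP[yv vy]; first exact: negbTE.
  apply/negP => xy.
  have xv : x != v by apply: contraTneq vx => ->; rewrite adj_irr.
  suff /existsP[z /and4P[zA vz xz zx]] :
      [exists z, [&& z \in A, adj v z, ~~ adj x z & z != x]].
    by case: (nopath z v x y) => //; rewrite 1?adj_sym // eq_sym.
  apply/existsPn => no_z.
  suff : #|N v| < #|N x| by rewrite ltnNge [_ <= _]vmax.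
  have vN : x \in N v by rewrite inE xA.
  have xN : v \in N x by rewrite inE vA adj_sym.
  rewrite (cardsD1 x) vN (cardsD1 v (N x)) xN ltn_add2l.
  apply: proper_card; apply/properP; split.
    apply/subsetP => z; rewrite !inE => /and3P[zx zA vz].
    have := no_z z; rewrite zA vz zx andbT negbK => ->.
    by rewrite !andbT; apply: contraTneq vz => ->; rewrite adj_irr.
  by exists y; rewrite !inE ?yA ?xy ?(negbTE vy) ?andbF // yv.
have [CeqA|CneA] := eqVneq C A.
  have [A1|A1] := eqVneq A [set v].
    by rewrite A1; apply: calG_iso (induced_set1 v) calG_point.
  have dom x : x \in A -> x != v -> adj v x.
    by rewrite -CeqA !inE => /predU1P[->|/andP[]//]; rewrite eqxx.
  apply: calG_iso (induced_cone vA dom) _; apply/calG_cone/IHn.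
    by rewrite -ltnS (leq_trans _ leAn) // [X in _ < X](cardsD1 v) vA.
  rewrite card_gt0; apply: contra_neq A1 => A0.
  by rewrite -(setD1K vA) A0 setU0.
have CproperA : C \proper A by rewrite properEneq CneA.
apply: calG_iso (induced_union CA sepC) _; apply: calG_union; apply: IHn.
- by rewrite -ltnS (leq_trans (proper_card CproperA)).
- by apply/card_gt0P; exists v; rewrite setU11.
- rewrite -ltnS (leq_trans _ leAn) // cardsD (setIidPr CA) ltn_subrL.
  apply/andP; split; apply/card_gt0P; exists v => //; exact: setU11.
- by rewrite card_gt0 setD_eq0; case/andP: CproperA.
Qed.
End InducedSubgraphs.

(** * Weighted automata and multiple context-free grammars *)

Section WeightedRuns.
Variables (T Q : finType) (step : Q -> T -> Q -> bool -> Prop).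

Fixpoint run (p : Q) (w : seq T) (q : Q) (n : nat) : Prop :=
  if w is a :: w' then
    exists r (k : bool) l, [/\ step p a r k, run r w' q l & n = k + l]
  else p = q /\ n = 0.

Lemma run_cat p u v q n :
  run p (u ++ v) q n <->
  exists r k l, [/\ run p u r k, run r v q l & n = k + l].
Proof.
elim: u p n => [|a u IHu] p n /=.
  split=> [pvq|[_ [_ [l [[<- ->] pvq ->]]]]] //.
  by exists p, 0, n; split.
split=> [[r [b [_ [par /IHu[s [k [l [rus svq ->]]]] ->]]]]|].
  exists s, (b + k), l; split=> //; last by rewrite addnA.
  by exists r, b, k.
move=> [s [_ [l [[r [b [k [par rus ->]]]] svq ->]]]].
exists r, b, (k + l); split=> //; last by rewrite addnA.
by apply/IHu; exists s, k, l.
Qed.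

(** A component marked [None] is one that the rules applied above it discard:
    it is read by no run and contributes no weight. *)
Definition spans (o : option (Q * Q)) (w : seq T) (n : nat) : Prop :=
  if o is Some pq then run pq.1 w pq.2 n else n = 0.

Section Fill.
Variable V : finType.
Implicit Types (s : seq (T + V)) (t : V -> seq T) (f : V -> nat).

Definition fill t s : seq T :=
  flatten [seq match x with inl a => [:: a] | inr v => t v end | x <- s].

Definition var_sum f s := \sum_(v : V) count_mem (inr v) s * f v.

Lemma var_sum_letter f a s : var_sum f (inl a :: s) = var_sum f s.
Proof. by apply: eq_bigr => v _. Qed.

Lemma var_sum_var f v s : var_sum f (inr v :: s) = f v + var_sum f s.
Proof.
rewrite /var_sum (bigD1 v) //= [in RHS](bigD1 v) //= eqxx mulnDl mul1n -addnA.
congr (_ + (_ + _)); apply: eq_bigr => u uv /=.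
by rewrite (inj_eq inr_inj) eq_sym (negbTE uv).
Qed.

Lemma eq_var_sum f g s :
  (forall v, inr v \in s -> f v = g v) -> var_sum f s = var_sum g s.
Proof.
move=> fg; apply: eq_bigr => v _.
have [/count_memPn->|/negPn/fg->//] := boolP (inr v \notin s).
by rewrite !mul0n.
Qed.

(** Cutting a run at the boundaries of the substituted variables. As each
    variable occurs once, it gets a single pair of end states, and any other
    words that join the same end states may be substituted instead: the weight
    is affine in those of the substituted words. *)
Lemma run_fill s : (forall v, count_mem (inr v) s <= 1) ->
  forall t p q n, run p (fill t s) q n ->
  exists (m : V -> option (Q * Q)) f c,
    [/\ c <= size s, forall v, inr v \in s -> spans (m v) (t v) (f v),
        n = c + var_sum f s &
        forall t' f', (forall v, inr v \in s -> spans (m v) (t' v) (f' v)) ->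
        run p (fill t' s) q (c + var_sum f' s)].
Proof.
elim: s => [|[a|v] s IHs] lin t p q n.
- case=> <- ->; exists (fun=> None), (fun=> 0), 0.
  have var_sum0 f : var_sum f [::] = 0 by rewrite /var_sum big1.
  by split=> // [|t' f' _]; rewrite var_sum0.
- case=> r [b [l [par rsq ->]]].
  have [v|m [f [c [c_le tf -> pump]]]] := IHs _ _ _ _ _ rsq; first exact: lin.
  exists m, f, (b + c); split=> [|v||t' f' t'f'] /=.
  + by rewrite -add1n leq_add // leq_b1.
  + by rewrite inE /=; apply: tf.
  + by rewrite var_sum_letter addnA.
  + exists r, b, (c + var_sum f' s); split; rewrite // ?var_sum_letter ?addnA //.
    by apply: pump => v vs; apply: t'f'; rewrite inE vs orbT.
- have vNs : inr v \notin s.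
    by have := lin v; rewrite /= eqxx add1n ltnS leqn0 => /eqP/count_memPn.
  have neq u : inr u \in s -> (u == v) = false.
    by move=> us; apply/eqP => uv; rewrite -uv us in vNs.
  move=> /run_cat[r [k [l [pvr rsq ->]]]].
  have [u|m [f [c [c_le tf -> pump]]]] := IHs _ _ _ _ _ rsq.
    by apply: leq_trans (lin u); rewrite /= leq_addl.
  exists (fun u => if u == v then Some (p, r) else m u).
  exists (fun u => if u == v then k else f u), c; split=> [|u||t' f' t'f'].
  + exact: leqW.
  + by rewrite inE (inj_eq inr_inj); case: eqP => [->|_ /tf].
  + rewrite var_sum_var eqxx addnCA; congr (_ + (_ + _)).
    by apply: eq_var_sum => u /neq->.
  + rewrite var_sum_var addnCA; apply/run_cat.
    exists r, (f' v), (c + var_sum f' s); split=> //.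
      by have := t'f' v; rewrite inE !eqxx; apply.
    by apply: pump => u us; have := t'f' u; rewrite neq // inE us orbT; apply.
Qed.

Lemma spans_fill o s : (forall v, count_mem (inr v) s <= 1) ->
  forall t n, spans o (fill t s) n ->
  exists (m : V -> option (Q * Q)) f c,
    [/\ c <= size s, forall v, inr v \in s -> spans (m v) (t v) (f v),
        n = c + var_sum f s &
        forall t' f', (forall v, inr v \in s -> spans (m v) (t' v) (f' v)) ->
        spans o (fill t' s) (c + var_sum f' s)].
Proof.
case: o => [[p q]|] lin t n; first exact: run_fill.
have var_sum0 f : (forall v, inr v \in s -> f v = 0) -> var_sum f s = 0.
  move=> f0; rewrite (@eq_var_sum f (fun=> 0)) //.
  by rewrite /var_sum big1 // => v _; rewrite muln0.
move=> /= ->; exists (fun=> None), (fun=> 0), 0.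
by split=> // *; rewrite var_sum0.
Qed.

(** Distinct components of a rule share no variable, so the markings of the
    variables found component by component glue to a single one. *)
Lemma spans_fill_all d (o : 'I_d -> option (Q * Q)) (s : 'I_d -> seq (T + V)) :
  (forall v, \sum_j count_mem (inr v) (s j) <= 1) ->
  forall t (g : 'I_d -> nat), (forall j, spans (o j) (fill t (s j)) (g j)) ->
  exists (m : V -> option (Q * Q)) f c,
    [/\ c <= \sum_j size (s j), forall v, spans (m v) (t v) (f v),
        \sum_j g j = c + \sum_v f v &
        forall t' f', (forall v, spans (m v) (t' v) (f' v)) ->
        exists2 g', forall j, spans (o j) (fill t' (s j)) (g' j) &
          \sum_j g' j = c + \sum_v f' v].
Proof.
move=> lin t g tg.
have count_le v j : count_mem (inr v) (s j) <= \sum_j count_mem (inr v) (s j).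
  by rewrite [X in _ <= X](bigD1 j) //= leq_addr.
have /fin_all_exists[m /fin_all_exists[f /fin_all_exists[c mfc]]] :=
  fun j => spans_fill (fun v => leq_trans (count_le v j) (lin v)) (tg j).
have home_uniq v i j : inr v \in s i -> inr v \in s j -> i = j.
  move=> vi vj; apply/eqP; apply: contraLR (lin v) => ij; rewrite -ltnNge.
  rewrite (bigD1 i) //= (bigD1 j) 1?eq_sym //= addnA (leq_trans _ (leq_addr _ _)) //.
  by rewrite -[2]/(1 + 1) leq_add // -has_count has_pred1.
pose home v := [pick j | inr v \in s j].
have homeE v j : inr v \in s j -> home v = Some j.
  rewrite /home => vj; case: pickP => [i vi|/(_ j)]; last by rewrite vj.
  by rewrite (home_uniq _ _ _ vi vj).
pose M v := if home v is Some j then m j v else None.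
have glue f' : (forall v, home v = None -> f' v = 0) ->
    \sum_j var_sum f' (s j) = \sum_v f' v.
  move=> f'0; rewrite exchange_big; apply: eq_bigr => v _ /=.
  rewrite -big_distrl /=; have := f'0 v.
  rewrite /home; case: pickP => [i vi _|_ ->] //; last by rewrite muln0.
  suff -> : \sum_j count_mem (inr v) (s j) = 1 by rewrite mul1n.
  apply/eqP; rewrite eqn_leq lin /= (bigD1 i) //= (leq_trans _ (leq_addr _ _)) //.
  by rewrite -has_count has_pred1.
exists M, (fun v => if home v is Some j then f j v else 0), (\sum_j c j).
split=> [|v||t' f' t'f'].
- by apply: leq_sum => j _; have [] := mfc j.
- rewrite /M /home; case: pickP => //= j vj.
  by have [_ tf _ _] := mfc j; exact: tf.
- rewrite -glue; last by move=> v ->.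
  rewrite -big_split; apply: eq_bigr => j _ /=.
  have [_ _ -> _] := mfc j; congr (_ + _); apply: eq_var_sum => v vj.
  by rewrite (homeE _ _ vj).
exists (fun j => c j + var_sum f' (s j)) => [j|].
  have [_ _ _ pump] := mfc j; apply: pump => v vj.
  by have := t'f' v; rewrite /M (homeE _ _ vj).
by rewrite big_split /= glue // => v v0; have := t'f' v; rewrite /M v0.
Qed.

End Fill.

Section Pumping.
Variable g : mcf_grammar T.

(** A marking prescribes the end states of the runs over the components of a
    tuple; there are finitely many. *)
Definition marking (A : nonterminal g) := {ffun 'I_(dim A) -> option (Q * Q)}.
Definition marked := {A : nonterminal g & marking A}.

Definition weighs A (m : marking A) (t : (dim A).-tuple (seq T)) (n : nat) :=
  exists2 f : 'I_(dim A) -> nat,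
    forall j, spans (m j) (tnth t j) (f j) & n = \sum_j f j.

Definition rule_size (k : rule_index g) :=
  \sum_j size (tnth (rule_comp (rule k)) j).

(** With markings as nonterminals the grammar becomes a context-free grammar over
    one letter: the last clause makes this decomposition reusable with any other
    tuples of the same markings. *)
Lemma weighs_rule (k : rule_index g) (m : marking (rule_lhs (rule k))) t n :
  weighs m (rule_fun t) n ->
  exists (m' : forall i, marking (rule_arg (rule k) i)) f c,
    [/\ c <= rule_size k, forall i, weighs (m' i) (t i) (f i),
        n = c + \sum_i f i &
        forall t' f', (forall i, weighs (m' i) (t' i) (f' i)) ->
        weighs m (rule_fun t') (c + \sum_i f' i)].
Proof.
set r := rule k in m t *; case=> h tf ->.
pose V := {i : 'I_(rule_arity r) & 'I_(dim (rule_arg r i))}.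
pose word (t : forall i, (dim (rule_arg r i)).-tuple (seq T)) (v : V) :=
  tnth (t (tag v)) (tagged v).
have substE t' s : rule_subst t' s = fill (word t') s.
  by congr flatten; apply: eq_map => -[|[]].
have compE t' j : tnth (rule_fun t') j = fill (word t') (tnth (rule_comp r) j).
  by rewrite tnth_map substE.
have lin (v : V) : \sum_j count_mem (inr v) (tnth (rule_comp r) j) <= 1.
  have := rule_linear v.
  by rewrite count_flatten sumnE big_map big_tuple.
have {}tf j : spans (m j) (fill (word t) (tnth (rule_comp r) j)) (h j).
  by rewrite -compE.
have [M [f [c [c_le Mtf -> pump]]]] := spans_fill_all lin tf.
have sumE (f' : V -> nat) : \sum_v f' v =
    \sum_i \sum_(j < dim (rule_arg r i))
      f' (Tagged (fun i => 'I_(dim (rule_arg r i))) j).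
  by rewrite sig_big_dep; apply: eq_bigr => -[].
exists (fun i => [ffun j => M (Tagged (fun i => 'I_(dim (rule_arg r i))) j)]).
exists (fun i => \sum_(j < dim (rule_arg r i))
  f (Tagged (fun i => 'I_(dim (rule_arg r i))) j)), c.
split=> // [i||t' f' t'f'].
- exists (fun j => f (Tagged (fun i => 'I_(dim (rule_arg r i))) j)) => // j.
  by rewrite ffunE; have := Mtf (Tagged (fun i => 'I_(dim (rule_arg r i))) j).
- by rewrite sumE.
have /fin_all_exists2[F t'F f'E] := t'f'.
have [|h' t'h' h'E] := pump (word t') (fun v => F (tag v) (tagged v)).
  by case=> i j; have := t'F i j; rewrite ffunE.
exists h' => [j|]; first by rewrite compE.
by rewrite h'E sumE; congr (_ + _); apply: eq_bigr => i _; rewrite f'E.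
Qed.

Definition value (X : marked) (n : nat) :=
  exists2 t, mcf_derives t & weighs (tagged X) t n.

(** The effect of a derivation tree of [X] with one subtree of [Y] removed is
    recorded only through the weights, which avoids manipulating trees. *)
Definition context (X Y : marked) (q : nat) :=
  forall n, value Y n -> value X (q + n).

Lemma context_refl X : context X X 0.
Proof. by []. Qed.

Lemma context_comp X Y Z a b : context X Y a -> context Y Z b -> context X Z (a + b).
Proof. by move=> XY YZ n /YZ/XY; rewrite addnA. Qed.

Lemma context_iter X q k : context X X q -> context X X (k * q).
Proof.
move=> XX; elim: k => [|k IHk]; first exact: context_refl.
by rewrite mulSn; apply: context_comp IHk.
Qed.

Definition below Y X := `[< exists q, context X Y q >].

Lemma below_refl X : below X X.
Proof. by apply/asboolP; exists 0; exact: context_refl. Qed.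

Lemma below_trans Y X Z : below X Y -> below Y Z -> below X Z.
Proof.
move=> /asboolP[a YX] /asboolP[b ZY]; apply/asboolP.
by exists (b + a); apply: context_comp YX.
Qed.

(** [below] is a preorder on a finite set, so its strict part is well founded:
    the rank is the induction measure that replaces the height of trees. *)
Definition rank X := #|[pred Y | below Y X]|.

Lemma rank_le X Y : below Y X -> rank Y <= rank X.
Proof.
move=> YX; apply: subset_leq_card; apply/subsetP => Z.
by rewrite !inE => /below_trans; apply.
Qed.

Lemma below_of_rank X Y : below Y X -> rank X <= rank Y -> below X Y.
Proof.
move=> YX; rewrite /rank => XY.
have sub : {subset [pred Z | below Z Y] <= [pred Z | below Z X]}.
  by move=> Z; rewrite !inE => /below_trans; apply.
have /subset_leqif_card/leqifP : [pred Z | below Z Y] \subset [pred Z | below Z X].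
  exact/subsetP.
case: ifP => [/subsetP/(_ X)|_]; last by rewrite ltnNge XY.
by rewrite !inE below_refl => /(_ isT).
Qed.

(** If no reachable marking pumps itself by a positive amount, two markings
    below each other take the same values: a child of the same rank as its parent
    then carries the whole weight, and any other child has smaller rank. Since
    the number of children and the constants of the rules are bounded, so are the
    values, by induction on the rank and then on the derivation. *)
Lemma value_bounded X0 :
  (forall X q n, below X X0 -> value X n -> context X X q -> q = 0) ->
  exists B, forall n, value X0 n -> n <= B.
Proof.
move=> nopump.
suff bound r : exists B, forall A (t : (dim A).-tuple (seq T)), mcf_derives t ->
    forall (m : marking A) n, weighs m t n ->
    below (Tagged marking m) X0 -> rank (Tagged marking m) <= r -> n <= B.
  have [B bnd] := bound (rank X0); exists B => n [t tD tn].
  case: X0 t tD tn {nopump bound} bnd => A m /= t tD tn bnd.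
  exact: bnd tD _ _ tn (below_refl _) _.
elim: r => [|r [B IHr]].
  exists 0 => A t _ m n _ _; rewrite leqn0.
  by move=> /eqP/card0_eq/(_ (Tagged marking m)); rewrite !inE below_refl.
pose C := \max_(k : rule_index g) rule_size k.
pose D := \max_(k : rule_index g) rule_arity (rule k).
exists (C + D * B) => A t; elim=> k {}t tD IHt m n tn mX0 rankm.
have [m' [f [c [c_le tf nE pump]]]] := weighs_rule tn.
set X := Tagged marking m in mX0 rankm *.
pose Y i := Tagged marking (m' i).
have ctx i : context X (Y i) (c + \sum_(i' | i' != i) f i').
  move=> x [/= t' t'D t'x].
  have /fin_all_exists2[u uD um] i' : exists2 u, mcf_derives u &
      weighs (m' i') u (if i' == i then x else f i').
    by case: eqP => [->|_]; [exists t' | exists (t i')].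
  exists (rule_fun u); first exact: MCFDerives.
  have := pump _ _ um; rewrite (bigD1 i) //= eqxx addnA addnAC => um'.
  congr (weighs _ _ _): um'; congr (_ + _ + _).
  by apply: eq_bigr => i' /negbTE->.
have YX i : below (Y i) X by apply/asboolP; eexists; exact: ctx.
have YX0 i : below (Y i) X0 by exact: below_trans (YX i) mX0.
have [/existsP[i rankYi]|/existsPn small] := boolP [exists i, rank X <= rank (Y i)].
  (* The child [i] pumps itself through [X], so its siblings weigh nothing. *)
  have /asboolP[q YX_q] := below_of_rank (YX i) rankYi.
  have valueX : value X n by exists (rule_fun t) => //; exact: MCFDerives.
  have /eqP := nopump _ _ _ mX0 valueX (context_comp (ctx i) YX_q).
  rewrite addn_eq0 => /andP[/eqP rest0 _].
  have -> : n = f i by rewrite nE (bigD1 i) //= addnCA rest0 addn0.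
  exact: IHt (tf i) (YX0 i) (leq_trans (rank_le (YX i)) rankm).
rewrite nE leq_add //; first exact: leq_trans c_le (leq_bigmax k).
apply: (@leq_trans (\sum_(i < rule_arity (rule k)) B)).
  apply: leq_sum => i _; apply: IHr (tD i) _ _ (tf i) (YX0 i) _.
  by have := small i; rewrite -ltnNge => /leq_trans-/(_ _ rankm).
by rewrite sum_nat_const card_ord leq_mul2r (leq_bigmax k) orbT.
Qed.

End Pumping.

(** Weak form of the semilinearity of multiple context-free languages, relative
    to an automaton. *)
Theorem mcf_weights (L : seq T -> Prop) (p q : Q) : multiple_context_free L ->
  (exists B, forall w n, L w -> run p w q n -> n <= B) \/
  (exists a d, 0 < d /\ forall k, exists2 w, L w & run p w q (a + k * d)).
Proof.
case=> g <-; 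
pose X0 : marked g :=
  Tagged (@marking g) ([ffun=> Some (p, q)] : marking (start g)).
have value_start n : value X0 n <-> exists2 w, mcf_lang g w & run p w q n.
  have sum1 (f : 'I_(dim (start g)) -> nat) j : \sum_i f i = f j.
    case: (dim _) (dim_start g) f j => [|[|]] // _ f j.
    by rewrite big_ord1 (ord1 j).
  have j0 : 'I_(dim (start g)) by rewrite dim_start; exact: ord0.
  have tE (t : (dim (start g)).-tuple (seq T)) : tval t = [:: tnth t j0].
    case: (dim _) (dim_start g) t j0 => [|[|]] // _ t j.
    by rewrite (ord1 j); case: t => -[|w [|]] // sz; rewrite (tnth_nth w).
  split=> [[/= t tD [f tf ->]]|[w [t tD]]].
    exists (tnth t j0); first by exists t.
    by rewrite (sum1 f j0); have := tf j0; rewrite ffunE.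
  rewrite tE => -[<-] pq; exists t => //; exists (fun=> n); last by rewrite sum1.
  move=> j; rewrite ffunE /=; suff -> : j = j0 by [].
  by move: j j0 {tE pq}; rewrite dim_start => j j0; rewrite !ord1.
case: (pselect (exists X a n d,
  [/\ context X0 X a, value X n, context X X d & 0 < d])).
  case=> X [a [n [d [X0X Xn XX d_gt0]]]]; right; exists (a + n), d; split=> // k.
  apply/value_start; rewrite -addnA; apply: X0X; rewrite addnC.
  exact: (context_iter k XX).
move=> nopump; left; have [|B bnd] := @value_bounded g X0.
  move=> X d n /asboolP[a X0X] Xn XX; apply/eqP; case: posnP => // d_gt0.
  by case: nopump; exists X, a, n, d.
by exists B => w n gw pq; apply/bnd/value_start; exists w.
Qed.

End WeightedRuns.

(** * Weighted rational subsets of a group *)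

Section RationalWeights.
Variables (G : groupType) (Q : finType) (E : seq (Q * G * Q * bool)).
Local Open Scope group_scope.

Inductive gpath : Q -> G -> Q -> nat -> Prop :=
| gpath_nil q : gpath q 1 q 0
| gpath_cons p x r (b : bool) y q n :
    (p, x, r, b) \in E -> gpath r y q n -> gpath p (x * y) q (b + n)%N.

Lemma gpath_cat p x q m y r n :
  gpath p x q m -> gpath q y r n -> gpath p (x * y) r (m + n)%N.
Proof.
elim=> {p x q m} [q|p x q b z s m pq _ IH] // pr; first by rewrite mul1g.
by rewrite -mulgA -addnA; apply: gpath_cons pq (IH pr).
Qed.

(** Allowing group elements as labels amounts to closure under inverse
    homomorphism, obtained here on the automaton instead of the grammar. A
    nonempty spelling over the alphabet is chosen for each label; the states of
    the automaton reading the alphabet are pairs of a vertex and of the part that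
    remains to be read of the spelling of the current edge. *)
Theorem mcf_rational_weights p q : has_mcf_word_problem G ->
  (exists B, forall n, gpath p 1 q n -> n <= B) \/
  (exists a d, 0 < d /\ forall k, gpath p 1 q (a + k * d)%N).
Proof.
case=> X mcfX; pose T := alphabet X; pose val := word_val X.
have [a0 _] : exists a, a \in T by apply/card_gt0P/alphabet_gt0.
have catE u v : val (u ++ v) = val u * val v by exact: word_val_cat.
have valE a w : val (a :: w) = val [:: a] * val w by rewrite -catE.
have /choice[spell spellE] x : exists aw : T * seq T, val (aw.1 :: aw.2) = x.
  (* The cancelling pair makes the spelling nonempty even when [x] is 1. *)
  have [w <-] := word_val_surj X x; exists (a0, letter_inv a0 :: w) => /=.
  by rewrite valE [val (_ :: w)]valE [val [:: letter_inv _]]word_val_inv mulVKg.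
pose N := \max_(e <- E) size (spell e.1.1.2).2.
have size_spell r x s b : (r, x, s, b) \in E -> size (spell x).2 <= N.
  move=> e; exact: (@leq_bigmax_seq _ E xpredT
    (fun e : Q * G * Q * bool => size (spell e.1.1.2).2) _ e isT).
pose S : finType := Q * N.-bseq T : Type.
pose step (u : S) (a : T) (v : S) (b : bool) :=
  [\/ [/\ u.2 = a :: v.2 :> seq T, u.1 = v.1 & b = false] |
      (u.2 = [::] :> seq T) /\
      exists2 x, (u.1, x, v.1, b) \in E & spell x = (a, v.2 : seq T)].
have run_gpath w u n :
    run step u w (q, [bseq]) n -> gpath u.1 ((val (bseqval u.2))^-1 * val w) q n.
  elim: w u n => [|a w IHw] u n /=.
    by case=> -> ->; rewrite mulVg; exact: gpath_nil.
  case=> v [b [l [uv vw ->]]]; case: uv => [[-> -> ->]|[-> [x ux spx]]].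
    by rewrite valE (valE _ w) invgM -mulgA mulKg; apply: IHw.
  rewrite [val [::]]word_val_nil invg1 mul1g.
  have := spellE x; rewrite spx /= => xE.
  have -> : val (a :: w) = x * ((val (bseqval v.2))^-1 * val w).
    by rewrite -xE valE (valE a v.2) mulgA mulgK.
  by apply: gpath_cons ux _; apply: IHw.
have finish r (s : N.-bseq T) w n :
    run step (r, [bseq]) w (q, [bseq]) n -> run step (r, s) (s ++ w) (q, [bseq]) n.
  move=> rw; case: s; elim=> [|a s IHs] sN.
    by congr (run step (r, _) w (q, _) n): rw; apply: val_inj.
  by exists (r, Bseq (ltnW sN)), false, n; split=> //; left.
have gpath_run r y n : gpath r y q n ->
    exists2 w, val w = y & run step (r, [bseq]) w (q, [bseq]) n.
  clear run_gpath => ry; elim: ry finish => {r y n} [r _|r x s b y {}q n e _ IH finish].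
    by exists [::]; first exact: word_val_nil.
  have [w yE sw] := IH finish; exists ((spell x).1 :: (spell x).2 ++ w).
    by rewrite -cat_cons catE yE -[in RHS](spellE x).
  exists (s, Bseq (size_spell _ _ _ _ e)), b, n; split; last by []; last exact: finish.
  by right; split=> //; exists x => //; exact: surjective_pairing.
have weightP n : gpath p 1 q n <->
    exists2 w, val w = 1 & run step (p, [bseq]) w (q, [bseq]) n.
  split=> [/gpath_run//|[w w1 /run_gpath]].
  by rewrite w1 /= [val _]word_val_nil invg1 mulg1.
case: (mcf_weights step (p, [bseq]) (q, [bseq]) mcfX) => [[B bnd]|[a [d [d_gt0 ap]]]].
  by left; exists B => n /weightP[w w1]; apply: bnd.
by right; exists a, d; split=> // k; apply/weightP; have [w] := ap k; exists w.
Qed.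
End RationalWeights.

(** * Positive words in a right-angled Artin group *)

Section FreeProjection.
Variables (Γ : sgraph) (x y : vertex Γ).
Hypothesis xy_nadj : ~~ adj x y.

Definition code (v : vertex Γ) : option bool :=
  if v == x then Some true else if v == y then Some false else None.

Definition inv_letter (l : bool * bool) := (l.1, ~~ l.2).

(** Left multiplication of reduced words of the free group of rank 2 by a letter:
    letting words act on reduced words stands in for the free group itself. *)
Definition push (l : bool * bool) s :=
  if s is h :: s' then if h == inv_letter l then s' else l :: s else [:: l].

Definition reduced := sorted (fun l h => h != inv_letter l).

Definition act_letter (l : vertex Γ * bool) s :=
  if code l.1 is Some t then push (t, l.2) s else s.

Definition act (u : raag_word Γ) s := foldr act_letter s u.

Lemma reduced_push l s : reduced s -> reduced (push l s).
Proof.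
case: s => // h s /=; case: ifP => [_|/negbT hl hs] /=; last by rewrite hl.
exact: path_sorted.
Qed.

Lemma push_inv l s : reduced s -> push l (push (inv_letter l) s) = s.
Proof.
have invK : inv_letter (inv_letter l) = l by case: l => t b; rewrite /inv_letter /= negbK.
case: s => [|h s] /=; first by rewrite eqxx.
rewrite invK; case: (eqVneq h l) => [->|_ _] /=; last by rewrite eqxx.
by case: s => //= h' s /andP[/negbTE->].
Qed.

Lemma reduced_act u s : reduced s -> reduced (act u s).
Proof.
elim: u => //= l u IHu /IHu; rewrite /act_letter.
by case: (code _) => // t; exact: reduced_push.
Qed.

(** This is why deleting all letters but [x] and [y] respects the commutations. *)
Lemma adj_code v w : adj v w -> code v = None \/ code w = None.
Proof.
rewrite /code; case: (eqVneq v x) => [->|_];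
  last case: (eqVneq v y) => [->|_]; last by left.
- case: (eqVneq w x) => [->|_]; first by rewrite adj_irr.
  by case: (eqVneq w y) => [->|_]; [rewrite (negbTE xy_nadj) | right].
- case: (eqVneq w x) => [->|_]; first by rewrite adj_sym (negbTE xy_nadj).
  by case: (eqVneq w y) => [->|_]; [rewrite adj_irr | right].
Qed.

Lemma act_cong u v s : raag_cong u v -> reduced s -> act u s = act v s.
Proof.
move=> uv; elim: uv s => {u v} //.
- by move=> u v _ IH s /IH.
- by move=> u v w _ IHu _ IHv s sr; rewrite IHu ?IHv.
- move=> u u' v v' _ IHu _ IHv s sr; rewrite /act !foldr_cat -!/(act _ _).
  by rewrite (IHv _ sr) IHu //; exact: reduced_act.
- move=> v b s sr; rewrite /act /= /act_letter /=; case: (code v) => // t.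
  exact: (@push_inv (t, b) s sr).
- move=> v w vw s _; rewrite /act /= /act_letter /=.
  by case: (adj_code vw) => ->.
Qed.

Definition positive (p : seq (vertex Γ)) : raag Γ :=
  raag_class [seq (v, true) | v <- p].

(** Positive words are reduced, hence recovered from their action on the empty
    word. *)
Lemma positive_proj p q : positive p = positive q -> pmap code p = pmap code q.
Proof.
have actE r : act [seq (v, true) | v <- r] [::] = [seq (t, true) | t <- pmap code r].
  elim: r => //= v r ->; rewrite /act_letter /=; case: (code v) => //= t.
  by case: (pmap code r) => //= t' l; rewrite xpair_eqE andbF.
move=> /raag_classP/act_cong-/(_ [::] isT); rewrite !actE.
by apply: inj_map => t t' [].
Qed.

End FreeProjection.

Section PositiveProducts.
Variable Γ : sgraph.
Local Open Scope group_scope.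
Implicit Types p q : seq (vertex Γ).

Lemma positive_cat p q : positive (p ++ q) = positive p * positive q.
Proof. by rewrite /positive map_cat -raag_mul_class. Qed.

Lemma positive_cons (v : vertex Γ) p : positive (v :: p) = positive [:: v] * positive p.
Proof. by rewrite -positive_cat. Qed.

Lemma positive_flatten_nseq n p : positive (flatten (nseq n p)) = positive p ^+ n.
Proof. by elim: n => // n IHn; rewrite expgS -IHn -positive_cat. Qed.

Lemma positive_nseq n (v : vertex Γ) : positive (nseq n v) = positive [:: v] ^+ n.
Proof. by rewrite -positive_flatten_nseq; congr positive; elim: n => //= n ->. Qed.

Lemma positive_commute (v w : vertex Γ) : adj v w -> commute (positive [:: v]) (positive [:: w]).
Proof.
by move=> vw; rewrite /commute -!positive_cat; apply/raag_classP/raag_cong_comm.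
Qed.

End PositiveProducts.

(** * Powers of two from an induced path or cycle *)

(** For the left word a d (c b b)^n1 a d (c b b)^n2 ..., with a, d coded by [true]
    and c, b by [false], this takes its projection to a, c to that to d, b. *)
Definition double_false (e : seq bool) :=
  flatten [seq if t then [:: true] else [:: false; false] | t <- e].

Lemma double_false_nseq n : double_false (nseq n false) = nseq n.*2 false.
Proof. by elim: n => //= n; rewrite /double_false /= => ->. Qed.

Lemma strip_false n s g s' :
  nseq n false ++ true :: s = g ++ true :: s' ->
  exists2 h, g = nseq n false ++ h & true :: s = h ++ true :: s'.
Proof.
elim: n g => [|n IHn] g /=; first by exists g.
by case: g => [//|t g] [<-] /IHn[h -> sh]; exists h.
Qed.

(** Unless [g] is empty, it starts with [true] and the block of length [2 n] that
    start the left side. Cancelling them on both sides leaves the same equation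
    for [2 n] and the rest of [g], the block being doubled by [double_false]. *)
Lemma doubling_pow2 n g m :
  true :: nseq n.*2 false ++ double_false g = g ++ true :: nseq m false ->
  exists k, m = n * 2 ^ k.+1.
Proof.
have [l] := ubnP (size g); elim: l n g => // l IHl n [_|t g] /=.
  rewrite cats0 => -[/(congr1 size)]; rewrite !size_nseq => <-.
  by exists 0; rewrite muln2.
rewrite ltnS => gl [<-]; rewrite {1}/double_false /= => /strip_false[h gE].
have hl : size h < l by rewrite (leq_ltn_trans _ gl) // gE size_cat leq_addl.
rewrite gE /double_false map_cat flatten_cat -!/(double_false _) double_false_nseq.
by move=> /(IHl _ _ hl)[k ->]; exists k.+1; rewrite -muln2 -mulnA -expnS.
Qed.

Lemma pow2_no_progression a d :
  0 < d -> ~ forall k, exists j, a + k * d = 2 ^ j.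
Proof.
(* Two terms of the progression beyond [d] differ by less than the first. *)
move=> d_gt0 ap; have [j jE] := ap d.+1; have [i iE] := ap d.+2.
have d_lt : d < 2 ^ j by rewrite -jE; nia.
have iE' : 2 ^ i = 2 ^ j + d by rewrite -jE -iE; lia.
have : 2 ^ j < 2 ^ i < 2 ^ j.+1.
  by rewrite iE' expnS mul2n -addnn !ltn_add2l d_lt -[X in X < _]addn0 ltn_add2l d_gt0.
by rewrite !ltn_exp2l // => /andP[ji]; rewrite ltnS leqNgt ji.
Qed.

Section InducedPath.
Variables (Γ : sgraph) (a b c d : vertex Γ).
Hypotheses (ab : adj a b) (bc : adj b c) (cd : adj c d).
Hypotheses (ac_neq : a != c) (bd_neq : b != d).
Hypotheses (ac_nadj : ~~ adj a c) (bd_nadj : ~~ adj b d).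
Local Open Scope group_scope.

Definition left_word (e : seq bool) :=
  flatten [seq if t then [:: a; d] else [:: c; b; b] | t <- e].

Definition right_prefix (f : seq bool) :=
  [:: a; c] ++ flatten [seq if t then [:: d; a] else [:: b; c] | t <- f].

Definition right_word (f : seq bool) (m : nat) := right_prefix f ++ d :: nseq m b.

Let neqs : [/\ a != b, b != c, c != d & a != d].
Proof.
split; [move: ab | move: bc | move: cd | move: cd]; apply: contraTneq.
- by move=> ->; rewrite adj_irr.
- by move=> ->; rewrite adj_irr.
- by move=> ->; rewrite adj_irr.
- by move=> <-; rewrite adj_sym.
Qed.

Lemma equal_words_weight e f m :
  positive (left_word e) = positive (right_word f m) -> exists k, m = (2 ^ k)%N.
Proof.
have [ab_neq bc_neq cd_neq ad_neq] := neqs.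
move=> KL; have := positive_proj ac_nadj KL.
have db_nadj : ~~ adj d b by rewrite adj_sym.
have := positive_proj db_nadj KL.
have acE : [/\ code a c a = Some true, code a c b = None, code a c c = Some false
    & code a c d = None].
  by rewrite /code !eqxx !(eq_sym _ a) !(eq_sym d) (negbTE ab_neq) (negbTE bc_neq)
    (negbTE ac_neq) (negbTE ad_neq) (negbTE cd_neq).
have dbE : [/\ code d b d = Some true, code d b a = None, code d b b = Some false
    & code d b c = None].
  by rewrite /code !eqxx !(eq_sym c b) (negbTE ab_neq) (negbTE bc_neq)
    (negbTE bd_neq) (negbTE ad_neq) (negbTE cd_neq).
case: acE dbE => aca acb acc acd [dbd dba dbb dbc].
have ac_K : pmap (code a c) (left_word e) = e.
  rewrite /left_word; elim: e {KL} => //= -[] e IHe /=;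
  by rewrite ?aca ?acb ?acc ?acd /= ?acb ?acd /= IHe.
have db_K e' : pmap (code d b) (left_word e') = double_false e'.
  rewrite /left_word /double_false; elim: e' => //= -[] e' IHe /=;
  by rewrite ?dba ?dbb ?dbc ?dbd /= ?dbb ?dbd /= IHe.
have ac_L : pmap (code a c) (right_word f m) = true :: false :: f.
  rewrite /right_word pmap_cat /= acd aca /= acc /=.
  have -> : pmap (code a c) (nseq m b) = [::] by elim: (m) => //= k; rewrite acb.
  rewrite cats0; do 2!congr cons; elim: f {KL} => //= -[] f IHf /=;
  by rewrite ?aca ?acb ?acc ?acd /= ?aca ?acc /= IHf.
have db_L : pmap (code d b) (right_word f m) = f ++ true :: nseq m false.
  rewrite /right_word pmap_cat /= dbd dba /= dbc /=.
  have -> : pmap (code d b) (nseq m b) = nseq m false.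
    by elim: (m) => //= k; rewrite dbb /= => ->.
  congr cat; elim: f {KL ac_L} => //= -[] f IHf /=;
  by rewrite ?dba ?dbb ?dbc ?dbd /= ?dba ?dbc /= IHf.
rewrite ac_K ac_L db_K db_L => + eE; rewrite eE => /(@doubling_pow2 1)[k ->].
by exists k.+1; rewrite mul1n.
Qed.

(** Both words are prolonged by a block. With m the current exponent, the
    remaining identity is b^m a d (c b b)^m = a (b c)^m d b^(2 m): b^m passes a
    and c^m passes d, so that the letters b of one block of the left word meet the
    letters c of its next block, and are matched with them in the right word. *)
Lemma equal_words_exist k : exists e f,
  positive (left_word e) = positive (right_word f (2 ^ k.+1)).
Proof.
pose A := positive [:: a]; pose B := positive [:: b].
pose C := positive [:: c]; pose D := positive [:: d].
have cAB : commute A B by exact: positive_commute.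
have cBC : commute B C by exact: positive_commute.
have cCD : commute C D by exact: positive_commute.
elim: k => [|k [e [f ef]]].
  exists [:: true; false], [::]; rewrite /left_word /right_word /=.
  rewrite !(positive_cons _ [:: _ & _]) -!/A -!/B -!/C -!/D.
  by congr (A * _); rewrite !mulgA cCD.
set m := (2 ^ k.+1)%N in ef *.
exists (e ++ true :: nseq m false), (f ++ true :: nseq m false).
have -> : (2 ^ k.+2 = m + m)%N by rewrite addnn -mul2n -expnS.
have -> : left_word (e ++ true :: nseq m false) =
    left_word e ++ [:: a; d] ++ flatten (nseq m [:: c; b; b]).
  by rewrite /left_word map_cat flatten_cat /= map_nseq.
have -> : right_word (f ++ true :: nseq m false) (m + m) =
    right_prefix f ++ [:: d; a] ++ flatten (nseq m [:: b; c]) ++ [:: d] ++ nseq (m + m) b.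
  by rewrite /right_word /right_prefix map_cat flatten_cat /= map_nseq -!catA.
rewrite positive_cat ef /right_word -cat1s -catA.
rewrite !positive_cat !positive_flatten_nseq !positive_nseq.
rewrite !(positive_cons _ [:: _ & _]) -!/A -!/B -!/C -!/D.
have -> : (C * (B * B)) ^+ m = C ^+ m * B ^+ (m + m).
  rewrite expgMn; last by apply: commuteM; exact: commute_sym.
  by rewrite expgMn // expgnDr.
rewrite (expgMn m cBC) -!mulgA; congr (_ * (_ * _)); rewrite !mulgA; congr (_ * _).
rewrite -!mulgA; congr (_ * (_ * _)).
rewrite mulgA -(commuteX m cAB) -!mulgA; congr (_ * (_ * _)).
exact: (commuteX m (commute_sym cCD)).
Qed.

Definition state k : 'I_4 := inord k.

Lemma stateE k : (k < 4)%N -> val (state k) = k.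
Proof. exact: inordK. Qed.

(** Loops at 0 spell the left word; the stretch from 1 to 3 spells the inverse of
    the right word, hence from its end. Only the letters of its final power of
    [b] have weight 1. *)
Definition doubling_edges : seq ('I_4 * raag Γ * 'I_4 * bool) :=
  [:: (state 0, positive [:: a; d], state 0, false);
      (state 0, positive [:: c; b; b], state 0, false);
      (state 0, 1, state 1, false);
      (state 1, (positive [:: b])^-1, state 1, true);
      (state 1, (positive [:: d])^-1, state 2, false);
      (state 2, (positive [:: d; a])^-1, state 2, false);
      (state 2, (positive [:: b; c])^-1, state 2, false);
      (state 2, (positive [:: a; c])^-1, state 3, false)].

Lemma left_word_cons t e :
  positive (left_word (t :: e)) =
  positive (if t then [:: a; d] else [:: c; b; b]) * positive (left_word e).
Proof. by rewrite -positive_cat. Qed.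

Lemma right_prefix_rcons f t :
  positive (right_prefix (rcons f t)) =
  positive (right_prefix f) * positive (if t then [:: d; a] else [:: b; c]).
Proof.
by rewrite /right_prefix -cats1 map_cat flatten_cat catA positive_cat /= cats0.
Qed.

Lemma right_wordE f m :
  positive (right_word f m) =
  positive (right_prefix f) * (positive [:: d] * positive [:: b] ^+ m).
Proof. by rewrite /right_word -cat1s !positive_cat positive_nseq. Qed.

Lemma doubling_path_inv p x q n : gpath doubling_edges p x q n -> q = state 3 ->
  match val p with
  | 0 => exists e f, x = positive (left_word e) * (positive (right_word f n))^-1
  | 1 => exists f, x = (positive (right_word f n))^-1
  | 2 => (exists f, x = (positive (right_prefix f))^-1) /\ n = 0
  | _ => x = 1 /\ n = 0
  end.
Proof.
elim=> {p x q n} [q ->|p x r b' y q n e _ IH q3]; first by rewrite stateE.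
move: e (IH q3); rewrite !inE.
case/orP=> [/eqP[-> -> -> ->]|]; rewrite ?stateE //=.
  by case=> e [f ->]; exists (true :: e), f; rewrite left_word_cons mulgA.
case/orP=> [/eqP[-> -> -> ->]|]; rewrite ?stateE //=.
  by case=> e [f ->]; exists (false :: e), f; rewrite left_word_cons mulgA.
case/orP=> [/eqP[-> -> -> ->]|]; rewrite ?stateE //=.
  by case=> f ->; exists [::], f.
case/orP=> [/eqP[-> -> -> ->]|]; rewrite ?stateE //=.
  by case=> f ->; exists f; rewrite !right_wordE add1n expgSr !mulgA -invgM.
case/orP=> [/eqP[-> -> -> ->]|]; rewrite ?stateE //=.
  by case=> -[f ->] ->; exists f; rewrite right_wordE mulg1 -invgM.
case/orP=> [/eqP[-> -> -> ->]|]; rewrite ?stateE //=.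
  case=> -[f ->] ->; split=> //; exists (rcons f true).
  by rewrite right_prefix_rcons invgM.
case/orP=> [/eqP[-> -> -> ->]|]; rewrite ?stateE //=.
  case=> -[f ->] ->; split=> //; exists (rcons f false).
  by rewrite right_prefix_rcons invgM.
case/eqP=> -> -> -> ->; rewrite ?stateE //=.
by case=> -> ->; split=> //; exists [::]; rewrite mulg1.
Qed.

Lemma doubling_path e f m :
  gpath doubling_edges (state 0)
    (positive (left_word e) * (positive (right_word f m))^-1) (state 3) m.
Proof.
have loop_K : gpath doubling_edges (state 0) (positive (left_word e)) (state 0) 0.
  elim: e => [|t e IHe]; first exact: gpath_nil.
  rewrite left_word_cons; apply: (@gpath_cons _ _ _ _ _ _ false _ _ 0) IHe.
  by case: t; rewrite !inE eqxx ?orbT.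
have loop_F : gpath doubling_edges (state 2) (positive (right_prefix f))^-1 (state 3) 0.
  elim/last_ind: f => [|f t IHf].
    rewrite -[_^-1]mulg1; apply: (@gpath_cons _ _ _ _ _ (state 3) false _ _ 0).
      by rewrite !inE eqxx !orbT.
    exact: gpath_nil.
  rewrite right_prefix_rcons invgM; apply: (@gpath_cons _ _ _ _ _ _ false _ _ 0) IHf.
  by case: t; rewrite !inE eqxx ?orbT.
have loop_L : gpath doubling_edges (state 1) (positive (right_word f m))^-1 (state 3) m.
  elim: m => [|m IHm].
    rewrite right_wordE mulg1 invgM; apply: (@gpath_cons _ _ _ _ _ _ false _ _ 0) loop_F.
    by rewrite !inE eqxx !orbT.
  have -> : positive (right_word f m.+1) = positive (right_word f m) * positive [:: b].
    by rewrite !right_wordE expgSr !mulgA.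
  rewrite invgM; apply: (@gpath_cons _ _ _ _ _ _ true _ _ m) IHm.
  by rewrite !inE eqxx !orbT.
rewrite -[m]add0n; apply: gpath_cat loop_K _; rewrite -[_^-1]mul1g.
apply: (@gpath_cons _ _ _ _ _ _ false _ _ m) loop_L.
by rewrite !inE eqxx !orbT.
Qed.

Lemma not_mcf_of_path : ~ has_mcf_word_problem (raag Γ).
Proof.
move=> /(mcf_rational_weights doubling_edges (state 0) (state 3)).
case=> [[B bnd]|[n [k [k_gt0 ap]]]].
  have [e [f ef]] := equal_words_exist B.
  have := doubling_path e f (2 ^ B.+1); rewrite ef mulgV => /bnd.
  by rewrite leqNgt (ltn_trans (ltnSn B)) // ltn_expl.
apply: (pow2_no_progression k_gt0) => i.
have := doubling_path_inv (ap i) erefl; rewrite stateE // => -[e [f]].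
move=> /esym/eqP; rewrite mulg_eq1 invgK => /eqP; exact: equal_words_weight.
Qed.

End InducedPath.

Theorem theorem12 (Γ : sgraph) (Γ_nonempty : 0 < #|vertex Γ|) :
  has_mcf_word_problem (raag Γ) -> calG Γ.
Proof.
move=> mcfΓ; apply: calG_of_no_path Γ_nonempty => a b c d ab bc cd ac bd nac nbd.
exact: (not_mcf_of_path ab bc cd ac bd nac nbd).
Qed.
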